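(* Let $\mathbb{C}$ be a pointed protomodular category admitting normalizers and let $f:X\to Z$ be a morphism in $\mathbb{C}$. If $X$ and $Z$ admit generic split extensions $$X\xrightarrow{k_X}H(X)\overset{p_X}{\underset{i_X}{\rightleftarrows}}[\![X]\!],\qquad Z\xrightarrow{k_Z}H(Z)\overset{p_Z}{\underset{i_Z}{\rightleftarrows}}[\![Z]\!],$$ then the object $[\![X,Z,f]\!]$ exists and forms part of a pullback $([\![X,Z,f]\!],u,q)$, with $u:[\![X,Z,f]\!]\to N$ and $q:[\![X,Z,f]\!]\to[\![X]\!]\times[\![Z]\!]$, of the morphisms $$N\xrightarrow{m}H(X)\times H(Z)\xleftarrow{i_X\times i_Z}[\![X]\!]\times[\![Z]\!],$$ where $(N,n,m)$ is the normalizer of $\langle k_X,k_Zf\rangle=(k_X\times k_Z)\langle 1,f\rangle:X\to H(X)\times H(Z)$ (so $n:X\to N$ and $mn=\langle k_X,k_Zf\rangle$).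
   Context: A split extension in a pointed category (of $B$ with kernel $X$) is a diagram $X\xrightarrow{\kappa}A\overset{\alpha}{\underset{\beta}{\rightleftarrows}}B$ with $\alpha:A\to B$, $\beta:B\to A$, where $\kappa$ is the kernel of $\alpha$ and $\alpha\beta=1_B$. A morphism of split extensions from $(X,A,B,\kappa,\alpha,\beta)$ to $(X',A',B',\kappa',\alpha',\beta')$ is a triple $u:X\to X'$, $v:A\to A'$, $w:B\to B'$ with $v\kappa=\kappa'u$, $v\beta=\beta'w$, $w\alpha=\alpha'v$. Pointed protomodular categories are by definition pointed, finitely complete and satisfy the split short five lemma: for each such morphism, $v$ is an isomorphism whenever $u$ and $w$ are. A generic split extension with kernel $X$ is a terminal object in the category of split extensions with kernel object $X$ and morphisms with $u=1_X$; it is written $X\xrightarrow{k_X}H(X)\overset{p_X}{\underset{i_X}{\rightleftarrows}}[\![X]\!]$ (with $p_X:H(X)\to[\![X]\!]$, $i_X:[\![X]\!]\to H(X)$), and $[\![X]\!]$ is called the split extension classifier of $X$. $\mathbb{C}^{\mathbf{2}}$ is the category of morphisms of $\mathbb{C}$ with objects triples $(X,Z,f)$, $f:X\to Z$. The object $[\![X,Z,f]\!]$ is the domain of the split extension classifier $[\![(X,Z,f)]\!]$ in $\mathbb{C}^{\mathbf{2}}$ (it exists when there is a generic split extension in $\mathbb{C}^{\mathbf{2}}$ with kernel $(X,Z,f)$). Equivalently, when $[\![Z]\!]$ exists, it is the representing object of the functor $\mathrm{SplExt}_{\mathbb{C}^{\mathbf{2}}}(\Delta(-),(X,Z,f)):\mathbb{C}^{\mathrm{op}}\to\mathbf{Set}$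 which sends $B$ to the set of isomorphism classes of split extensions in $\mathbb{C}^{\mathbf{2}}$ of $\Delta(B)=(B,B,1_B)$ with kernel $(X,Z,f)$ (isomorphisms being the identity on $\Delta(B)$ and on the kernel) and acts on morphisms by pullback. Normalizers (in the sense of Bourn and Gray): for a monomorphism $g:X'\to Y$, consider data consisting of morphisms $n:X'\to N$, $m:N\to Y$ with $mn=g$, an equivalence relation $r_1,r_2:R\to N$ on $N$, and a morphism $\kappa:X'\to R$ such that the square $\langle r_1,r_2\rangle\kappa=\langle 0,1\rangle n$ is a pullback, where $\langle r_1,r_2\rangle:R\to N\times N$ and $\langle 0,1\rangle:N\to N\times N$. A normalizer of $g$ is such data that is universal: for any other such data $(N',m',n',R',r_1',r_2',\kappa')$ there is a unique pair $h:N'\to N$, $v:R'\to R$ with $mh=m'$, $hn'=n$, $v\kappa'=\kappa$ and $\langle r_1,r_2\rangle v=(h\times h)\langle r_1',r_2'\rangle$. In a protomodular category $R$ is determined up to isomorphism by $n$, so the normalizer is written $(N,n,m)$. $\mathbb{C}$ admits normalizers if each monomorphism has one. *)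

(* Defs.v *)
From Stdlib Require Import List FinFun ProofIrrelevance RelationClasses.
Import ListNotations.

Set Implicit Arguments.
Unset Strict Implicit.
Unset Printing Implicit Defensive.

Declare Scope cat_scope.
Delimit Scope cat_scope with cat.
Open Scope cat_scope.

Record Category := {
  ob :> Type;
  hom : ob -> ob -> Type;
  idm : forall X, hom X X;
  comp : forall X Y Z, hom Y Z -> hom X Y -> hom X Z;
  comp_id_l : forall X Y (f : hom X Y), comp (idm Y) f = f;
  comp_id_r : forall X Y (f : hom X Y), comp f (idm X) = f;
  comp_assoc : forall W X Y Z (h : hom Y Z) (g : hom X Y) (f : hom W X),
    comp h (comp g f) = comp (comp h g) f
}.

Arguments hom {c} X Y.
Arguments idm {c} X.
Arguments comp {c X Y Z} g f.
Notation "g ∘ f" := (comp g f) (at level 40, left associativity) : cat_scope.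

Definition IsMono (C : Category) (X Y : C) (f : hom X Y) : Prop :=
  forall T (a b : hom T X), f ∘ a = f ∘ b -> a = b.

Definition IsIso (C : Category) (X Y : C) (f : hom X Y) : Prop :=
  exists g : hom Y X, g ∘ f = idm X /\ f ∘ g = idm Y.

Definition IsPullback (C : Category) (A B D P : C) (f : hom A D) (g : hom B D)
    (p : hom P A) (q : hom P B) : Prop :=
  f ∘ p = g ∘ q /\
  forall T (a : hom T A) (b : hom T B), f ∘ a = g ∘ b ->
    exists! h : hom T P, p ∘ h = a /\ q ∘ h = b.

Record Functor (J C : Category) := {
  fob :> J -> C;
  fmap : forall j k : J, hom j k -> hom (fob j) (fob k);
  fmap_id : forall j : J, fmap (idm j) = idm (fob j);
  fmap_comp : forall (i j k : J) (g : hom j k) (f : hom i j),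
    fmap (g ∘ f) = fmap g ∘ fmap f
}.

Record Cone (J C : Category) (D : Functor J C) := {
  apex : C;
  leg : forall j : J, hom apex (D j);
  leg_natural : forall (j k : J) (h : hom j k), fmap D h ∘ leg j = leg k
}.

Record Limit (J C : Category) (D : Functor J C) := {
  lim_cone :> Cone D;
  lim_map : forall K : Cone D, hom (apex K) (apex lim_cone);
  lim_map_leg : forall (K : Cone D) (j : J),
    leg lim_cone j ∘ lim_map K = leg K j;
  lim_map_unique : forall (K : Cone D) (h : hom (apex K) (apex lim_cone)),
    (forall j : J, leg lim_cone j ∘ h = leg K j) -> h = lim_map K
}.

Definition IsFiniteCategory (J : Category) : Prop :=
  Finite J /\ forall j k : J, Finite (hom j k).

Definition FinitelyComplete (C : Category) : Type :=
  forall (J : Category) (D : Functor J C), IsFiniteCategory J -> Limit D.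

Definition discrete_bool : Category := {|
  ob := bool;
  hom := fun a b => a = b;
  idm := fun a => eq_refl;
  comp := fun a b c g f => eq_trans f g;
  comp_id_l := fun a b f => proof_irrelevance _ _ _;
  comp_id_r := fun a b f => proof_irrelevance _ _ _;
  comp_assoc := fun a b c d h g f => proof_irrelevance _ _ _
|}.

Lemma discrete_bool_finite : IsFiniteCategory discrete_bool.
Proof.
split.
- exists [true; false]; intros [|]; simpl; auto.
- intros j k.
  assert (jk : j = k \/ j <> k) by (destruct j, k; auto; right; discriminate).
  destruct jk as [e | ne].
  + exists [e]; intro e'; left; exact (proof_irrelevance (j = k) e e').
  + exists []; intro e; exact (ne e).
Qed.

Section Products.

Variables (C : Category) (L : FinitelyComplete C).

Definition pair_functor (A B : C) : Functor discrete_bool C.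
Proof.
refine {|
  fob := fun b : discrete_bool => if b then A else B;
  fmap := fun (j k : discrete_bool) (e : j = k) =>
    match e in _ = k return hom (if j then A else B) (if k then A else B) with
    | eq_refl => idm _
    end |}.
- reflexivity.
- intros i j k g f; simpl in *; destruct g, f; simpl.
  symmetry; apply comp_id_l.
Defined.

Definition pair_cone (A B T : C) (a : hom T A) (b : hom T B) :
  Cone (pair_functor A B).
Proof.
refine (@Build_Cone _ _ (pair_functor A B) T
  (fun j : discrete_bool =>
    if j return hom T (if j then A else B) then a else b) _).
intros j k e; simpl in *; destruct e; apply comp_id_l.
Defined.

Definition prod_limit (A B : C) : Limit (pair_functor A B) :=
  L (pair_functor A B) discrete_bool_finite.

Definition product (A B : C) : C := apex (prod_limit A B).

Definition pr1 (A B : C) : hom (product A B) A := leg (prod_limit A B) true.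

Definition pr2 (A B : C) : hom (product A B) B := leg (prod_limit A B) false.

Definition pairing (A B T : C) (a : hom T A) (b : hom T B) : hom T (product A B) :=
  lim_map (prod_limit A B) (pair_cone a b).

Definition prod_map (A B A' B' : C) (f : hom A A') (g : hom B B') :
    hom (product A B) (product A' B') :=
  pairing (f ∘ pr1 A B) (g ∘ pr2 A B).

Lemma pr1_pairing (A B T : C) (a : hom T A) (b : hom T B) :
  pr1 A B ∘ pairing a b = a.
Proof. exact (lim_map_leg (prod_limit A B) (pair_cone a b) true). Qed.

Lemma pr2_pairing (A B T : C) (a : hom T A) (b : hom T B) :
  pr2 A B ∘ pairing a b = b.
Proof. exact (lim_map_leg (prod_limit A B) (pair_cone a b) false). Qed.

Lemma pairing_unique (A B T : C) (a : hom T A) (b : hom T B)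
    (h : hom T (product A B)) :
  pr1 A B ∘ h = a -> pr2 A B ∘ h = b -> h = pairing a b.
Proof.
intros ha hb.
apply (lim_map_unique (l := prod_limit A B) (K := pair_cone a b)).
intros [|]; assumption.
Qed.

End Products.

Record PointedCategory := {
  pcat :> Category;
  zero : pcat;
  from_zero : forall X, hom zero X;
  to_zero : forall X, hom X zero;
  from_zero_unique : forall X (f : hom zero X), f = from_zero X;
  to_zero_unique : forall X (f : hom X zero), f = to_zero X
}.

Definition zero_map (C : PointedCategory) (X Y : C) : hom X Y :=
  from_zero Y ∘ to_zero X.
Arguments zero_map {C} X Y.

Definition IsKernel (C : PointedCategory) (X A B : C)
    (alpha : hom A B) (kappa : hom X A) : Prop :=
  alpha ∘ kappa = zero_map X B /\
  forall T (t : hom T A), alpha ∘ t = zero_map T B ->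
    exists! s : hom T X, kappa ∘ s = t.

Record SplitExt (C : PointedCategory) (X B : C) := {
  mid : C;
  kappa : hom X mid;
  alpha : hom mid B;
  beta : hom B mid;
  kappa_kernel : IsKernel alpha kappa;
  alpha_beta : alpha ∘ beta = idm B
}.

Definition IsSplitExtMor (C : PointedCategory) (X B X' B' : C)
    (E : SplitExt X B) (E' : SplitExt X' B')
    (u : hom X X') (v : hom (mid E) (mid E')) (w : hom B B') : Prop :=
  v ∘ kappa E = kappa E' ∘ u /\
  v ∘ beta E = beta E' ∘ w /\
  w ∘ alpha E = alpha E' ∘ v.
Arguments IsSplitExtMor {C X B X' B'} E E' u v w.

(* [G] is terminal among the split extensions with kernel object [X] and the
   morphisms between them that are the identity on [X]. *)
Definition IsGeneric (C : PointedCategory) (X B : C) (G : SplitExt X B) : Prop :=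
  forall (B' : C) (E : SplitExt X B'),
    exists! vw : hom (mid E) (mid G) * hom B' B,
      IsSplitExtMor E G (idm X) (fst vw) (snd vw).

Definition SplitShortFiveLemma (C : PointedCategory) : Prop :=
  forall (X B X' B' : C) (E : SplitExt X B) (E' : SplitExt X' B')
    (u : hom X X') (v : hom (mid E) (mid E')) (w : hom B B'),
    IsSplitExtMor E E' u v w -> IsIso u -> IsIso w -> IsIso v.

Record ProtomodularCategory := {
  protocat :> PointedCategory;
  finitely_complete : FinitelyComplete protocat;
  split_short_five : SplitShortFiveLemma protocat
}.
Arguments finitely_complete p : clear implicits.

Notation "A × B" := (product (finitely_complete _) A B)
  (at level 40, left associativity) : cat_scope.
Notation "⟨ a , b ⟩" := (pairing (finitely_complete _) a b)
  (at level 0, a at level 99, b at level 99) : cat_scope.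
Notation "f ×m g" := (prod_map (finitely_complete _) f g)
  (at level 40, left associativity) : cat_scope.

(* The image of [(r1, r2)] on generalized elements of shape [T]; an internal
   equivalence relation is a jointly monic pair for which this is an
   equivalence relation for every [T]. *)
Definition related (C : Category) (R N : C) (r1 r2 : hom R N) (T : C)
    (a b : hom T N) : Prop :=
  exists c : hom T R, r1 ∘ c = a /\ r2 ∘ c = b.

Definition IsEquivalenceRelation (C : Category) (R N : C)
    (r1 r2 : hom R N) : Prop :=
  (forall T (c d : hom T R), r1 ∘ c = r1 ∘ d -> r2 ∘ c = r2 ∘ d -> c = d) /\
  forall T : C, Equivalence (@related C R N r1 r2 T).

Record NormalizerData (C : ProtomodularCategory) (X Y : C) (g : hom X Y) := {
  nz_ob : C;
  nz_n : hom X nz_ob;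
  nz_m : hom nz_ob Y;
  nz_mn : nz_m ∘ nz_n = g;
  nz_rel : C;
  nz_r1 : hom nz_rel nz_ob;
  nz_r2 : hom nz_rel nz_ob;
  nz_equiv : IsEquivalenceRelation nz_r1 nz_r2;
  nz_kappa : hom X nz_rel;
  nz_pullback : IsPullback ⟨nz_r1, nz_r2⟩ ⟨zero_map nz_ob nz_ob, idm nz_ob⟩
                  nz_kappa nz_n
}.

Definition IsNormalizer (C : ProtomodularCategory) (X Y : C) (g : hom X Y)
    (D : NormalizerData g) : Prop :=
  forall D' : NormalizerData g,
    exists! hv : hom (nz_ob D') (nz_ob D) * hom (nz_rel D') (nz_rel D),
      nz_m D ∘ fst hv = nz_m D' /\
      fst hv ∘ nz_n D' = nz_n D /\
      snd hv ∘ nz_kappa D' = nz_kappa D /\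
      ⟨nz_r1 D, nz_r2 D⟩ ∘ snd hv
        = (fst hv ×m fst hv) ∘ ⟨nz_r1 D', nz_r2 D'⟩.

Definition AdmitsNormalizers (C : ProtomodularCategory) : Prop :=
  forall (X Y : C) (g : hom X Y), IsMono g ->
    exists D : NormalizerData g, IsNormalizer D.

Record Arrow (C : Category) := {
  arr_dom : C;
  arr_cod : C;
  arr_map : hom arr_dom arr_cod
}.

Record ArrowMor (C : Category) (f g : Arrow C) := {
  amor_dom : hom (arr_dom f) (arr_dom g);
  amor_cod : hom (arr_cod f) (arr_cod g);
  amor_comm : arr_map g ∘ amor_dom = amor_cod ∘ arr_map f
}.

Lemma ArrowMor_eq (C : Category) (f g : Arrow C) (a b : ArrowMor f g) :
  amor_dom a = amor_dom b -> amor_cod a = amor_cod b -> a = b.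
Proof.
destruct a as [a1 a2 ha], b as [b1 b2 hb]; simpl; intros e1 e2; subst.
now rewrite (proof_irrelevance _ ha hb).
Qed.

Definition arrow_id (C : Category) (f : Arrow C) : ArrowMor f f.
Proof.
refine {| amor_dom := idm _; amor_cod := idm _ |}.
now rewrite comp_id_l, comp_id_r.
Defined.

Definition arrow_comp (C : Category) (f g h : Arrow C)
  (b : ArrowMor g h) (a : ArrowMor f g) : ArrowMor f h.
Proof.
refine {| amor_dom := amor_dom b ∘ amor_dom a;
          amor_cod := amor_cod b ∘ amor_cod a |}.
now rewrite comp_assoc, (amor_comm b), <- comp_assoc, (amor_comm a), comp_assoc.
Defined.

Definition arrow_category (C : Category) : Category.
Proof.
refine {| ob := Arrow C; hom := @ArrowMor C; idm := @arrow_id C;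
          comp := @arrow_comp C |}.
- intros; apply ArrowMor_eq; apply comp_id_l.
- intros; apply ArrowMor_eq; apply comp_id_r.
- intros; apply ArrowMor_eq; apply comp_assoc.
Defined.

Section ArrowPointed.

Variable C : PointedCategory.

Definition arrow_zero : Arrow C := {| arr_map := idm (zero C) |}.

Definition arrow_from_zero (f : Arrow C) : ArrowMor arrow_zero f.
Proof.
refine (@Build_ArrowMor C arrow_zero f
  (from_zero (arr_dom f)) (from_zero (arr_cod f)) _).
simpl; rewrite comp_id_r; apply from_zero_unique.
Defined.

Definition arrow_to_zero (f : Arrow C) : ArrowMor f arrow_zero.
Proof.
refine (@Build_ArrowMor C f arrow_zero
  (to_zero (arr_dom f)) (to_zero (arr_cod f)) _).
simpl; rewrite comp_id_l; symmetry; apply to_zero_unique.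
Defined.

Definition arrow_pointed : PointedCategory.
Proof.
refine (@Build_PointedCategory (arrow_category C)
  arrow_zero arrow_from_zero arrow_to_zero _ _).
- intros f a; apply ArrowMor_eq; apply from_zero_unique.
- intros f a; apply ArrowMor_eq; apply to_zero_unique.
Defined.

End ArrowPointed.

(* Main.v *)
Require Import Defs.
From Stdlib Require Import List.
Import ListNotations.

Set Implicit Arguments.
Unset Strict Implicit.
Unset Printing Implicit Defensive.

(** A split extension of [b : B -> B'] with kernel [f : X -> Z] in the category
    of morphisms amounts to a split extension [E] of [B] with kernel [X], one
    [E'] of [B'] with kernel [Z], and a morphism [(f, a, b)] from [E] to [E'],
    because kernels of morphisms are computed on domains and on codomains
    ([arrow_kernel_dom], [arrow_kernel_cod], [arrow_kernel]).  Since [E'] has a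
    unique morphism to the generic split extension [GZ], a generic split
    extension with kernel [f] can be sought with codomain part [GZ].  Its domain
    part must then be universal among the split extensions [E] with kernel [X]
    equipped with a morphism [(f, v2, w2)] from [E] to [GZ]; this reduction is
    [arrow_split_ext_generic].

    Let [E] be such a split extension, with middle object [A], and let
    [(1, v1, w1)] be its morphism to [GX].  The map [⟨v1, v2⟩] from [A] to
    [H(X) × H(Z)] restricts on [X] to [⟨kX, kZ f⟩], and [X] is normal in [A]; so
    the normalizer gives [h : A -> N] with [m h = ⟨v1, v2⟩], carrying the kernel
    pair of [A -> B] into the relation [R] on [N] ([normalizer_universal]).
    Composing [h] with the section [B -> A] gives a map [B -> N] whose image
    under [m] is [⟨iX w1, iZ w2⟩], that is, a map from [B] to the pullback [P]
    of [m] along [iX × iZ].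

    Conversely, [R] with its first projection, the diagonal and [X -> R] is a
    split extension of [N] with kernel [X].  Its pullback [G] along
    [u : P -> N] maps to [H(X)] and [H(Z)] by the second projection of [R]
    followed by [m] and the product projections.  These two maps are parts of
    morphisms of split extensions to [GX] and [GZ], because on the section
    [P -> G] they take the values of [m u = (iX × iZ) q]; the compatibility with
    the retractions is automatic, since in a protomodular category the kernel
    and the section of a split extension are jointly epic
    ([split_ext_jointly_epic]).  [G] is the required universal split extension
    ([normalizer_pullback_represents]): the morphism [E -> G] sends an element
    [y] of [A] to the pair [(h (beta (alpha y)), h y)] of [R], and any morphism
    [E -> G] followed by the second projection of [R] has the characteristic
    properties of [h], hence is [h].

    So the classifier exists with domain [P], and any other classifier is
    isomorphic to it. *)

(** * Finite limits *)

Inductive cospan_ob : Set := cospan_left | cospan_right | cospan_corner.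

Definition cospan_hom (j k : cospan_ob) : Prop :=
  match j, k with
  | cospan_left, cospan_left | cospan_right, cospan_right
  | _, cospan_corner => True
  | _, _ => False
  end.

Definition cospan : Category.
Proof.
unshelve refine {| ob := cospan_ob; hom := cospan_hom |}.
- intros []; exact I.
- intros [] [] []; simpl; tauto.
- intros [] [] []; reflexivity || contradiction.
- intros [] [] []; reflexivity || contradiction.
- intros [] [] [] [] [] [] []; reflexivity.
Defined.

Lemma cospan_finite : IsFiniteCategory cospan.
Proof.
split.
- exists [cospan_left; cospan_right; cospan_corner]; intros []; simpl; auto.
- intros [] []; (now exists []; intros []) || (exists [I]; intros []; simpl; auto).
Qed.

Definition cospan_functor (C : Category) (A B D : C) (f : hom A D) (g : hom B D) :
  Functor cospan C.
Proof.
unshelve refine (@Build_Functor cospan C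
  (fun j : cospan_ob => match j with
    | cospan_left => A | cospan_right => B | cospan_corner => D end) _ _ _).
- intros [] [] h; first [exact (idm _) | exact f | exact g | destruct h].
- intros []; reflexivity.
- intros [] [] [] [] []; simpl; now rewrite ?comp_id_l, ?comp_id_r.
Defined.

Definition cospan_cone (C : Category) (A B D : C) (f : hom A D) (g : hom B D)
  (T : C) (a : hom T A) (b : hom T B) (e : f ∘ a = g ∘ b) :
  Cone (cospan_functor f g).
Proof.
refine (@Build_Cone _ _ (cospan_functor f g) T
  (fun j : cospan => match j return hom T (cospan_functor f g j) with
    | cospan_left => a | cospan_right => b | cospan_corner => f ∘ a end) _).
intros [] [] []; simpl; now rewrite ?comp_id_l.
Defined.

Lemma pullback_exists (C : Category) (L : FinitelyComplete C)
  (A B D : C) (f : hom A D) (g : hom B D) :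
  exists (P : C) (p : hom P A) (q : hom P B), IsPullback f g p q.
Proof.
set (K := L _ (cospan_functor f g) cospan_finite).
assert (el := @leg_natural _ _ _ K cospan_left cospan_corner I).
assert (er := @leg_natural _ _ _ K cospan_right cospan_corner I).
exists (apex K), (leg K cospan_left), (leg K cospan_right).
split; [exact (eq_trans el (eq_sym er)) |].
intros T a b e; exists (lim_map K (cospan_cone e)); split.
- split; [exact (lim_map_leg K (cospan_cone e) cospan_left)
         | exact (lim_map_leg K (cospan_cone e) cospan_right)].
- intros h [ha hb]; symmetry.
  apply (lim_map_unique (l := K) (K := cospan_cone e)).
  intros []; [exact ha | exact hb |].
  simpl; rewrite <- ha, comp_assoc; f_equal; symmetry; exact el.
Qed.

Lemma pullback_jointly_monic (C : Category) (A B D P : C) (f : hom A D)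
  (g : hom B D) (p : hom P A) (q : hom P B) (HP : IsPullback f g p q)
  (T : C) (x y : hom T P) :
  p ∘ x = p ∘ y -> q ∘ x = q ∘ y -> x = y.
Proof.
intros ep eq; destruct HP as [e HP].
destruct (HP T (p ∘ y) (q ∘ y)) as [z [_ Hz]].
- now rewrite !comp_assoc, e.
- now rewrite <- (Hz x (conj ep eq)), <- (Hz y (conj eq_refl eq_refl)).
Qed.

Lemma pullback_precomp_iso (C : Category) (A B D P Q : C) (f : hom A D)
  (g : hom B D) (p : hom P A) (q : hom P B) (i : hom Q P) :
  IsPullback f g p q -> IsIso i -> IsPullback f g (p ∘ i) (q ∘ i).
Proof.
intros [e HP] [j [ji ij]]; split; [now rewrite !comp_assoc, e |].
intros T a b hab; destruct (HP T a b hab) as [h [[ha hb] Hh]].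
exists (j ∘ h); split.
- rewrite !(comp_assoc _ j h), <- !(comp_assoc _ i j), ij, !comp_id_r; now split.
- intros x [xa xb]; rewrite (Hh (i ∘ x)), comp_assoc, ji, comp_id_l; auto.
  now rewrite !comp_assoc.
Qed.

Lemma product_jointly_monic (C : Category) (L : FinitelyComplete C) (A B T : C)
  (x y : hom T (product L A B)) :
  pr1 L A B ∘ x = pr1 L A B ∘ y -> pr2 L A B ∘ x = pr2 L A B ∘ y -> x = y.
Proof.
intros e1 e2; rewrite (pairing_unique e1 e2); symmetry.
now apply pairing_unique.
Qed.

Lemma pr1_prod_map (C : Category) (L : FinitelyComplete C) (A B A' B' : C)
  (f : hom A A') (g : hom B B') :
  pr1 L A' B' ∘ prod_map L f g = f ∘ pr1 L A B.
Proof. apply pr1_pairing. Qed.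

Lemma pr2_prod_map (C : Category) (L : FinitelyComplete C) (A B A' B' : C)
  (f : hom A A') (g : hom B B') :
  pr2 L A' B' ∘ prod_map L f g = g ∘ pr2 L A B.
Proof. apply pr2_pairing. Qed.

(** * Split extensions *)

Lemma zero_map_precomp (C : PointedCategory) (X Y T : C) (t : hom T X) :
  zero_map X Y ∘ t = zero_map T Y.
Proof.
unfold zero_map; rewrite <- comp_assoc; f_equal; apply to_zero_unique.
Qed.

Lemma zero_map_postcomp (C : PointedCategory) (X Y T : C) (t : hom Y T) :
  t ∘ zero_map X Y = zero_map X T.
Proof.
unfold zero_map; rewrite comp_assoc; f_equal; apply from_zero_unique.
Qed.

Lemma kernel_mono (C : PointedCategory) (X A B : C) (alpha : hom A B)
  (kappa : hom X A) : IsKernel alpha kappa -> IsMono kappa.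
Proof.
intros [e H] T a b hab; destruct (H T (kappa ∘ b)) as [s [_ Hs]].
- now rewrite comp_assoc, e, zero_map_precomp.
- now rewrite <- (Hs a hab), <- (Hs b eq_refl).
Qed.

Lemma split_ext_mor_comp (C : PointedCategory) (X B X' B' X'' B'' : C)
  (E : SplitExt X B) (E' : SplitExt X' B') (E'' : SplitExt X'' B'')
  u v w u' v' w' :
  IsSplitExtMor E E' u v w -> IsSplitExtMor E' E'' u' v' w' ->
  IsSplitExtMor E E'' (u' ∘ u) (v' ∘ v) (w' ∘ w).
Proof.
intros [k [b a]] [k' [b' a']]; split; [| split].
- now rewrite <- comp_assoc, k, comp_assoc, k', comp_assoc.
- now rewrite <- comp_assoc, b, comp_assoc, b', comp_assoc.
- now rewrite <- comp_assoc, a, comp_assoc, a', comp_assoc.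
Qed.

Lemma split_ext_mor_id (C : PointedCategory) (X B : C) (E : SplitExt X B) :
  IsSplitExtMor E E (idm X) (idm _) (idm B).
Proof. repeat split; now rewrite comp_id_l, comp_id_r. Qed.

(** Terminal objects are isomorphic; only the component on the bases is kept. *)
Lemma generic_base_iso (C : PointedCategory) (X B B' : C)
  (G : SplitExt X B) (G' : SplitExt X B') :
  IsGeneric G -> IsGeneric G' -> exists i : hom B B', IsIso i.
Proof.
assert (endo : forall (B0 : C) (G0 : SplitExt X B0) v w, IsGeneric G0 ->
  IsSplitExtMor G0 G0 (idm X) v w -> w = idm B0).
{ intros B0 G0 v w H0 hvw; destruct (H0 _ G0) as [z [_ Hz]].
  assert (e := Hz (v, w) hvw).
  rewrite (Hz (idm _, idm _) (split_ext_mor_id G0)) in e.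
  exact (eq_sym (f_equal snd e)). }
intros HG HG'.
destruct (HG' _ G) as [[v w] [hvw _]], (HG _ G') as [[v' w'] [hvw' _]].
exists w, w'; split.
- apply (endo _ G (v' ∘ v)); [exact HG |].
  rewrite <- (comp_id_l (idm X)); exact (split_ext_mor_comp hvw hvw').
- apply (endo _ G' (v ∘ v')); [exact HG' |].
  rewrite <- (comp_id_l (idm X)); exact (split_ext_mor_comp hvw' hvw).
Qed.

(** The equalizer [e : Q -> A] of [a] and [b] contains both the kernel and the
    section, so [Q] is again a split extension with the same kernel and base,
    and [e] is a morphism over identities: by the split short five lemma it is
    an isomorphism. *)
Lemma split_ext_jointly_epic (C : ProtomodularCategory) (X B : C)
  (E : SplitExt X B) (T : C) (a b : hom (mid E) T) :
  a ∘ kappa E = b ∘ kappa E -> a ∘ beta E = b ∘ beta E -> a = b.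
Proof.
intros ek eb.
(* The equalizer of [a] and [b] is the pullback of [⟨a, b⟩] along the diagonal. *)
destruct (pullback_exists (finitely_complete C) ⟨a, b⟩ ⟨idm T, idm T⟩)
  as [Q [e [d HQ]]].
assert (ea : a ∘ e = d /\ b ∘ e = d).
{ split; [rewrite <- (pr1_pairing (finitely_complete C) a b)
         | rewrite <- (pr2_pairing (finitely_complete C) a b)];
    rewrite <- comp_assoc, (proj1 HQ), comp_assoc, ?pr1_pairing, ?pr2_pairing;
    apply comp_id_l. }
destruct ea as [ea eb'].
assert (lift : forall S (t : hom S (mid E)), a ∘ t = b ∘ t ->
  exists t' : hom S Q, e ∘ t' = t).
{ intros S t et; destruct (proj2 HQ S t (a ∘ t)) as [t' [[h _] _]].
  - apply product_jointly_monic; rewrite !comp_assoc, ?pr1_pairing, ?pr2_pairing,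
      <- ?et, comp_id_l; reflexivity.
  - now exists t'. }
assert (me : IsMono e).
{ intros S x y hxy; apply (pullback_jointly_monic HQ); [exact hxy |].
  now rewrite <- ea, <- !comp_assoc, hxy. }
destruct (lift _ _ ek) as [k hk], (lift _ _ eb) as [s hs].
assert (ker : IsKernel (alpha E ∘ e) k).
{ split.
  - rewrite <- comp_assoc, hk; apply kappa_kernel.
  - intros S t ht; rewrite <- comp_assoc in ht.
    destruct (proj2 (kappa_kernel E) S _ ht) as [r [hr Hr]].
    exists r; split.
    + apply me; now rewrite comp_assoc, hk.
    + intros r' hr'; apply Hr; now rewrite <- hr', comp_assoc, hk. }
assert (sec : (alpha E ∘ e) ∘ s = idm B)
  by (rewrite <- comp_assoc, hs; apply alpha_beta).
destruct (@split_short_five C X B X B (Build_SplitExt ker sec) E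
  (idm X) e (idm B)) as [j [_ ij]].
- repeat split; simpl; rewrite ?comp_id_l, ?comp_id_r; auto.
- exists (idm X); split; apply comp_id_l.
- exists (idm B); split; apply comp_id_l.
- simpl in j, ij.
  now rewrite <- (comp_id_r a), <- (comp_id_r b), <- ij, !comp_assoc, ea, eb'.
Qed.

(** Both sides of [w ∘ alpha = alpha' ∘ v] vanish on the kernel and equal [w] on
    the section. *)
Lemma split_ext_mor_of_kappa_beta (C : ProtomodularCategory) (X B X' B' : C)
  (E : SplitExt X B) (E' : SplitExt X' B') u v w :
  v ∘ kappa E = kappa E' ∘ u -> v ∘ beta E = beta E' ∘ w ->
  IsSplitExtMor E E' u v w.
Proof.
intros ek eb; split; [exact ek | split; [exact eb |]].
apply split_ext_jointly_epic; rewrite <- !comp_assoc.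
- rewrite ek, (comp_assoc (alpha E')), (proj1 (kappa_kernel E)),
    (proj1 (kappa_kernel E')), zero_map_postcomp, zero_map_precomp.
  reflexivity.
- now rewrite eb, (comp_assoc (alpha E')), !alpha_beta, comp_id_l, comp_id_r.
Qed.

Lemma pullback_split_ext (C : ProtomodularCategory) (X B B' : C)
  (E : SplitExt X B) (u : hom B' B) :
  exists (E' : SplitExt X B') (p : hom (mid E') (mid E)),
    IsSplitExtMor E' E (idm X) p u /\ IsPullback (alpha E) u p (alpha E').
Proof.
destruct (pullback_exists (finitely_complete C) (alpha E) u) as [Q [p [q HQ]]].
destruct (proj2 HQ X (kappa E) (zero_map X B')) as [k [[pk qk] _]].
{ rewrite zero_map_postcomp; apply kappa_kernel. }
destruct (proj2 HQ B' (beta E ∘ u) (idm B')) as [s [[ps qs] _]].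
{ now rewrite comp_assoc, alpha_beta, comp_id_l, comp_id_r. }
assert (ker : IsKernel q k).
{ split; [exact qk |]; intros T t ht.
  destruct (proj2 (kappa_kernel E) T (p ∘ t)) as [r [hr Hr]].
  - now rewrite comp_assoc, (proj1 HQ), <- comp_assoc, ht, zero_map_postcomp.
  - exists r; split.
    + apply (pullback_jointly_monic HQ); rewrite comp_assoc.
      * now rewrite pk.
      * now rewrite qk, ht, zero_map_precomp.
    + intros r' hr'; apply Hr; now rewrite <- hr', comp_assoc, pk. }
exists (Build_SplitExt ker qs), p; split; [| exact HQ].
apply split_ext_mor_of_kappa_beta; simpl; now rewrite ?comp_id_r.
Qed.

(** * Normalizers *)

Lemma normalizer_rel_kappa (C : ProtomodularCategory) (X Y : C) (g : hom X Y)
  (D : NormalizerData g) :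
  nz_r1 D ∘ nz_kappa D = zero_map _ _ /\ nz_r2 D ∘ nz_kappa D = nz_n D.
Proof.
assert (e := proj1 (nz_pullback D)).
split; [rewrite <- (pr1_pairing (finitely_complete C) (nz_r1 D) (nz_r2 D))
       | rewrite <- (pr2_pairing (finitely_complete C) (nz_r1 D) (nz_r2 D))];
  rewrite <- comp_assoc, e, comp_assoc, ?pr1_pairing, ?pr2_pairing.
- apply zero_map_precomp.
- apply comp_id_l.
Qed.

(** The pullback square of a normalizer says that [X] is the class of zero under
    the relation, that is, the elements [(0, y)] of it. *)
Lemma normalizer_rel_kernel (C : ProtomodularCategory) (X Y : C) (g : hom X Y)
  (D : NormalizerData g) : IsKernel (nz_r1 D) (nz_kappa D).
Proof.
destruct (normalizer_rel_kappa D) as [k1 k2].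
split; [exact k1 |]; intros T t ht.
destruct (proj2 (nz_pullback D) T t (nz_r2 D ∘ t)) as [s [[hs hs'] Hs]].
- apply product_jointly_monic; rewrite !comp_assoc, ?pr1_pairing, ?pr2_pairing.
  + now rewrite ht, !zero_map_precomp.
  + now rewrite comp_id_l.
- exists s; split; [exact hs |].
  intros r hr; apply Hs; split; [exact hr |].
  now rewrite <- hr, comp_assoc, k2.
Qed.

Lemma normalizer_rel_diagonal (C : ProtomodularCategory) (X Y : C) (g : hom X Y)
  (D : NormalizerData g) :
  exists s : hom (nz_ob D) (nz_rel D),
    nz_r1 D ∘ s = idm _ /\ nz_r2 D ∘ s = idm _.
Proof.
destruct (proj2 (nz_equiv D) (nz_ob D)) as [refl _ _].
exact (refl (idm _)).
Qed.

(** The universal property of a normalizer, tested on a kernel with the kernel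
    pair of its quotient map as equivalence relation.  Stating the compatibility
    of [h] with the relations on generalized elements replaces the second
    component of the universal pair: the relation being jointly monic, that
    component is determined by [h]. *)
Lemma normalizer_universal (C : ProtomodularCategory) (X Y : C) (g : hom X Y)
  (D : NormalizerData g) (HD : IsNormalizer D)
  (A B : C) (alpha : hom A B) (kappa : hom X A) (Hk : IsKernel alpha kappa)
  (m' : hom A Y) (Hm : m' ∘ kappa = g) :
  exists! h : hom A (nz_ob D),
    nz_m D ∘ h = m' /\ h ∘ kappa = nz_n D /\
    forall T (a b : hom T A), alpha ∘ a = alpha ∘ b ->
      @related _ _ _ (nz_r1 D) (nz_r2 D) T (h ∘ a) (h ∘ b).
Proof.
destruct (pullback_exists (finitely_complete C) alpha alpha) as [K [p1 [p2 HK]]].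
assert (equiv : IsEquivalenceRelation p1 p2).
{ split; [exact (pullback_jointly_monic HK) |].
  assert (rel : forall T (a b : hom T A),
    @related _ _ _ p1 p2 T a b <-> alpha ∘ a = alpha ∘ b).
  { intros T a b; split.
    - intros [c [<- <-]]; now rewrite !comp_assoc, (proj1 HK).
    - intros e; destruct (proj2 HK T a b e) as [c [hc _]]; now exists c. }
  intros T; split.
  - intros a; now apply rel.
  - intros a b hab; apply rel; symmetry; now apply rel.
  - intros a b c hab hbc; apply rel.
    transitivity (alpha ∘ b); now apply rel. }
(* The class of zero under the kernel pair is the kernel. *)
destruct (proj2 HK X (zero_map X A) kappa) as [k [[pk1 pk2] _]].
{ rewrite zero_map_postcomp; symmetry; apply Hk. }
assert (pb : IsPullback ⟨p1, p2⟩ ⟨zero_map A A, idm A⟩ k kappa).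
{ split.
  - apply product_jointly_monic; rewrite !comp_assoc, ?pr1_pairing, ?pr2_pairing.
    + now rewrite pk1, zero_map_precomp.
    + now rewrite pk2, comp_id_l.
  - intros T a b e.
    assert (e1 := f_equal (comp (pr1 (finitely_complete C) A A)) e).
    assert (e2 := f_equal (comp (pr2 (finitely_complete C) A A)) e).
    rewrite !comp_assoc, !pr1_pairing, zero_map_precomp in e1.
    rewrite !comp_assoc, !pr2_pairing, comp_id_l in e2.
    destruct (proj2 Hk T b) as [s [hs Hs]].
    { now rewrite <- e2, comp_assoc, <- (proj1 HK), <- comp_assoc, e1,
        zero_map_postcomp. }
    exists s; split.
    + split; [| exact hs]; apply (pullback_jointly_monic HK); rewrite comp_assoc.
      * now rewrite pk1, e1, zero_map_precomp.
      * now rewrite pk2, e2.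
    + intros r [_ hr]; now apply Hs. }
set (D' := {| nz_mn := Hm; nz_equiv := equiv; nz_pullback := pb |}).
destruct (normalizer_rel_kappa D) as [k1 k2].
destruct (HD D') as [[h v] [[hm [hn [_ hv]]] Huniq]]; simpl in *.
assert (v1 := f_equal (comp (pr1 (finitely_complete C) _ _)) hv).
assert (v2 := f_equal (comp (pr2 (finitely_complete C) _ _)) hv).
rewrite !comp_assoc, pr1_prod_map, pr1_pairing, <- comp_assoc, pr1_pairing in v1.
rewrite !comp_assoc, pr2_prod_map, pr2_pairing, <- comp_assoc, pr2_pairing in v2.
exists h; split.
- split; [exact hm | split; [exact hn |]].
  intros T a b e; destruct (proj2 HK T a b e) as [c [[<- <-] _]].
  exists (v ∘ c); now rewrite !comp_assoc, v1, v2.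
- intros h' [hm' [hn' rel]].
  (* The two projections are the generic pair of related elements. *)
  destruct (rel K p1 p2 (proj1 HK)) as [v' [v1' v2']].
  refine (f_equal fst (Huniq (h', v') _)); simpl.
  split; [exact hm' | split; [exact hn' | split]].
  + apply (proj1 (nz_equiv D)); rewrite comp_assoc.
    * now rewrite v1', <- comp_assoc, pk1, zero_map_postcomp, k1.
    * now rewrite v2', <- comp_assoc, pk2, hn', k2.
  + apply product_jointly_monic; rewrite !comp_assoc.
    * now rewrite pr1_prod_map, pr1_pairing, <- comp_assoc, pr1_pairing.
    * now rewrite pr2_prod_map, pr2_pairing, <- comp_assoc, pr2_pairing.
Qed.

(** The universal extension is the pullback along [u] of the relation of the normalizer,
    viewed as a split extension of [N] by its first projection; as the second
    projection restricts to [n] on [X] and to [u] on [P], it supplies the maps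
    to [H(X)] and [H(Z)]. *)
Lemma normalizer_pullback_represents (C : ProtomodularCategory) (X Z : C)
  (f : hom X Z) (clX clZ : C) (GX : SplitExt X clX) (GZ : SplitExt Z clZ)
  (HGX : IsGeneric GX)
  (D : NormalizerData ⟨kappa GX, kappa GZ ∘ f⟩) (HD : IsNormalizer D)
  (P : C) (u : hom P (nz_ob D)) (q : hom P (clX × clZ))
  (HP : IsPullback (nz_m D) (beta GX ×m beta GZ) u q) :
  exists (G : SplitExt X P) (a : hom (mid G) (mid GZ)),
    IsSplitExtMor G GZ f a (pr2 (finitely_complete C) clX clZ ∘ q) /\
    forall (B : C) (E : SplitExt X B) (v2 : hom (mid E) (mid GZ)) (w2 : hom B clZ),
      IsSplitExtMor E GZ f v2 w2 ->
      exists! tw : hom (mid E) (mid G) * hom B P,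
        IsSplitExtMor E G (idm X) (fst tw) (snd tw) /\
        a ∘ fst tw = v2 /\ pr2 (finitely_complete C) clX clZ ∘ q ∘ snd tw = w2.
Proof.
destruct (normalizer_rel_kappa D) as [k1 k2].
destruct (normalizer_rel_diagonal D) as [s [s1 s2]].
set (R := Build_SplitExt (normalizer_rel_kernel D) s1).
destruct (pullback_split_ext R u) as [G [p [[pk [pb pa]] HG]]]; simpl in *.
rewrite comp_id_r in pk.
assert (mono := proj1 (nz_equiv D)).
set (L := finitely_complete C) in *.
set (a' := pr1 L _ _ ∘ nz_m D ∘ nz_r2 D ∘ p).
set (a := pr2 L _ _ ∘ nz_m D ∘ nz_r2 D ∘ p).
assert (mu1 : pr1 L _ _ ∘ nz_m D ∘ u = beta GX ∘ (pr1 L _ _ ∘ q))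
  by now rewrite <- comp_assoc, (proj1 HP), !comp_assoc, pr1_prod_map.
assert (mu2 : pr2 L _ _ ∘ nz_m D ∘ u = beta GZ ∘ (pr2 L _ _ ∘ q))
  by now rewrite <- comp_assoc, (proj1 HP), !comp_assoc, pr2_prod_map.
assert (r2u : nz_r2 D ∘ p ∘ beta G = u)
  by now rewrite <- comp_assoc, pb, comp_assoc, s2, comp_id_l.
assert (r2n : nz_r2 D ∘ p ∘ kappa G = nz_n D)
  by now rewrite <- comp_assoc, pk.
assert (Hx : IsSplitExtMor G GX (idm X) a' (pr1 L _ _ ∘ q)).
{ apply split_ext_mor_of_kappa_beta; unfold a'.
  - rewrite <- !comp_assoc, (comp_assoc (nz_r2 D)), r2n, nz_mn, pr1_pairing.
    now rewrite comp_id_r.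
  - now rewrite <- (comp_assoc _ (nz_r2 D)), <- (comp_assoc _ _ (beta G)), r2u. }
assert (Ha : IsSplitExtMor G GZ f a (pr2 L _ _ ∘ q)).
{ apply split_ext_mor_of_kappa_beta; unfold a.
  - now rewrite <- !comp_assoc, (comp_assoc (nz_r2 D)), r2n, nz_mn, pr2_pairing.
  - now rewrite <- (comp_assoc _ (nz_r2 D)), <- (comp_assoc _ _ (beta G)), r2u. }
exists G, a; split; [exact Ha |].
intros B E v2 w2 [vk2 [vb2 va2]].
destruct (HGX B E) as [[v1 w1] [[vk1 [vb1 va1]] HX]]; simpl in *.
rewrite comp_id_r in vk1.
destruct (normalizer_universal HD (kappa_kernel E) (m' := ⟨v1, v2⟩))
  as [h [[hm [hn hr]] Hh]].
{ apply product_jointly_monic; rewrite comp_assoc, ?pr1_pairing, ?pr2_pairing; auto. }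
destruct (proj2 HP B (h ∘ beta E) ⟨w1, w2⟩) as [w [[wu wq] Hw]].
{ rewrite comp_assoc, hm; apply product_jointly_monic; rewrite !comp_assoc.
  - now rewrite pr1_prod_map, <- !comp_assoc, !pr1_pairing, comp_assoc, pr1_pairing.
  - now rewrite pr2_prod_map, <- !comp_assoc, !pr2_pairing, comp_assoc, pr2_pairing. }
(* An element [y] and its image [beta (alpha y)] have the same image under
   [alpha], so their images under [h] form an element of the relation. *)
destruct (hr _ (beta E ∘ alpha E) (idm _)) as [c [c1 c2]].
{ now rewrite comp_assoc, alpha_beta, comp_id_l, comp_id_r. }
rewrite comp_id_r in c2.
destruct (proj2 HG _ c (w ∘ alpha E)) as [t [[tp ta] Ht]].
{ now rewrite c1, !comp_assoc, wu. }
exists (t, w); split; simpl.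
- split; [| split].
  + apply split_ext_mor_of_kappa_beta; apply (pullback_jointly_monic HG);
      rewrite !comp_assoc.
    * rewrite tp, pk, comp_id_r; apply mono; rewrite comp_assoc.
      -- now rewrite c1, k1, <- !comp_assoc, (proj1 (kappa_kernel E)),
           !zero_map_postcomp.
      -- now rewrite c2, k2.
    * now rewrite ta, comp_id_r, (proj1 (kappa_kernel G)), <- comp_assoc,
        (proj1 (kappa_kernel E)), zero_map_postcomp.
    * rewrite tp, pb; apply mono; rewrite !comp_assoc.
      -- now rewrite c1, s1, comp_id_l, wu, <- !comp_assoc, alpha_beta, comp_id_r.
      -- now rewrite c2, s2, comp_id_l, wu.
    * now rewrite ta, alpha_beta, comp_id_l, <- comp_assoc, alpha_beta, comp_id_r.
  + unfold a; now rewrite <- !comp_assoc, tp, c2, hm, pr2_pairing.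
  + now rewrite <- comp_assoc, wq, pr2_pairing.
- intros [t' w'] [mor [at' qw']]; simpl in *.
  assert (morX := split_ext_mor_comp mor Hx); rewrite comp_id_l in morX.
  assert (eX := HX (a' ∘ t', pr1 L clX clZ ∘ q ∘ w') morX).
  injection eX as ev1 ew1.
  destruct mor as [tk' [tb' ta']]; rewrite comp_id_r in tk'.
  assert (eh : h = nz_r2 D ∘ p ∘ t').
  { apply Hh; split; [| split].
    - apply product_jointly_monic; rewrite !comp_assoc, ?pr1_pairing, ?pr2_pairing.
      + now rewrite ev1.
      + exact at'.
    - now rewrite <- comp_assoc, tk'.
    - intros T y y' e.
      (* Being the two components of [p ∘ t' ∘ y], the elements
         [u (w' (alpha y))] and [h y] are related; the former depends only on
         [alpha y]. *)
      destruct (proj2 (nz_equiv D) T) as [_ sym trans].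
      apply (trans _ (u ∘ w' ∘ alpha E ∘ y)).
      + apply sym; exists (p ∘ t' ∘ y); rewrite !comp_assoc; split; [| reflexivity].
        now rewrite <- pa, <- (comp_assoc u), <- ta', comp_assoc.
      + exists (p ∘ t' ∘ y'); rewrite !comp_assoc; split; [| reflexivity].
        now rewrite <- (comp_assoc _ (alpha E) y), e, !comp_assoc, <- pa,
          <- (comp_assoc u), <- ta', comp_assoc. }
  assert (ew : w = w').
  { apply Hw; split.
    - now rewrite eh, <- comp_assoc, tb', comp_assoc, r2u.
    - apply product_jointly_monic; rewrite ?pr1_pairing, ?pr2_pairing, comp_assoc;
        auto. }
  f_equal; [| exact ew].
  apply Ht; split.
  + apply mono; rewrite comp_assoc.
    * now rewrite c1, <- pa, <- comp_assoc, <- ta', <- ew, !comp_assoc, wu.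
    * now rewrite c2, eh.
  + now rewrite <- ta', ew.
Qed.

(** * Split extensions of morphisms *)

(** Testing the kernel on identity morphisms [T = T]: morphisms out of these are
    the same as morphisms from [T] to the domain. *)
Lemma arrow_kernel_dom (C : PointedCategory) (F A B : arrow_pointed C)
  (al : hom A B) (k : hom F A) :
  IsKernel al k -> IsKernel (amor_dom al) (amor_dom k).
Proof.
intros [e H]; split; [exact (f_equal (@amor_dom _ _ _) e) |].
intros T t ht.
set (T1 := {| arr_map := idm T |} : arrow_pointed C).
assert (build : forall (F' : arrow_pointed C) (x : hom T (arr_dom F')),
  { y : @hom (arrow_pointed C) T1 F' |
      amor_dom y = x /\ amor_cod y = arr_map F' ∘ x }).
{ intros F' x; unshelve eexists.
  - refine (@Build_ArrowMor C T1 F' x (arr_map F' ∘ x) _).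
    simpl; now rewrite comp_id_r.
  - split; reflexivity. }
destruct (build A t) as [t1 [td tc]].
destruct (H T1 t1) as [s [hs Hs]].
{ apply ArrowMor_eq; simpl; rewrite ?td, ?tc; [exact ht |].
  rewrite comp_assoc, <- (amor_comm al), <- comp_assoc, ht.
  apply zero_map_postcomp. }
exists (amor_dom s); split.
- rewrite <- td, <- hs; reflexivity.
- intros r hr; destruct (build F r) as [r1 [rd rc]].
  rewrite <- rd, (Hs r1); [reflexivity |].
  apply ArrowMor_eq; simpl; rewrite ?rd, ?rc, ?td, ?tc; [exact hr |].
  now rewrite comp_assoc, <- (amor_comm k), <- comp_assoc, hr.
Qed.

(** Testing the kernel on the morphisms [0 -> T]: morphisms out of these are the
    same as morphisms from [T] to the codomain. *)
Lemma arrow_kernel_cod (C : PointedCategory) (F A B : arrow_pointed C)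
  (al : hom A B) (k : hom F A) :
  IsKernel al k -> IsKernel (amor_cod al) (amor_cod k).
Proof.
intros [e H]; split; [exact (f_equal (@amor_cod _ _ _) e) |].
intros T t ht.
set (T1 := {| arr_map := from_zero T |} : arrow_pointed C).
assert (build : forall (F' : arrow_pointed C) (x : hom T (arr_cod F')),
  { y : @hom (arrow_pointed C) T1 F' | amor_cod y = x }).
{ intros F' x; unshelve eexists.
  - refine (@Build_ArrowMor C T1 F' (from_zero _) x _).
    simpl; rewrite (from_zero_unique (_ ∘ _)); symmetry; apply from_zero_unique.
  - reflexivity. }
assert (eq : forall (F' : arrow_pointed C) (x y : @hom (arrow_pointed C) T1 F'),
  amor_cod x = amor_cod y -> x = y).
{ intros F' x y hxy; apply ArrowMor_eq; [| exact hxy].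
  rewrite (from_zero_unique (amor_dom x)); symmetry; apply from_zero_unique. }
destruct (build A t) as [t1 tc].
destruct (H T1 t1) as [s [hs Hs]].
{ apply eq; simpl; now rewrite tc. }
exists (amor_cod s); split.
- rewrite <- tc, <- hs; reflexivity.
- intros r hr; destruct (build F r) as [r1 rc].
  rewrite <- rc, (Hs r1); [reflexivity |].
  apply eq; simpl; now rewrite rc, tc.
Qed.

Lemma arrow_kernel (C : PointedCategory) (F A B : arrow_pointed C)
  (al : hom A B) (k : hom F A) :
  IsKernel (amor_dom al) (amor_dom k) -> IsKernel (amor_cod al) (amor_cod k) ->
  IsKernel al k.
Proof.
intros H1 H2; split.
- apply ArrowMor_eq; [apply H1 | apply H2].
- intros T t ht.
  destruct (proj2 H1 _ (amor_dom t) (f_equal (@amor_dom _ _ _) ht)) as [s1 [hs1 Hs1]].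
  destruct (proj2 H2 _ (amor_cod t) (f_equal (@amor_cod _ _ _) ht)) as [s2 [hs2 Hs2]].
  assert (e : arr_map F ∘ s1 = s2 ∘ arr_map T).
  { apply (kernel_mono H2).
    rewrite !comp_assoc, hs2, <- (amor_comm k), <- comp_assoc, hs1.
    apply amor_comm. }
  exists (Build_ArrowMor e); split.
  + now apply ArrowMor_eq.
  + intros r hr; apply ArrowMor_eq; simpl.
    * apply Hs1; now rewrite <- hr.
    * apply Hs2; now rewrite <- hr.
Qed.

Definition dom_split_ext (C : PointedCategory) (F B : arrow_pointed C)
  (E : SplitExt F B) : SplitExt (arr_dom F) (arr_dom B) :=
  Build_SplitExt (arrow_kernel_dom (kappa_kernel E))
    (f_equal (@amor_dom _ _ _) (alpha_beta E)).

Definition cod_split_ext (C : PointedCategory) (F B : arrow_pointed C)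
  (E : SplitExt F B) : SplitExt (arr_cod F) (arr_cod B) :=
  Build_SplitExt (arrow_kernel_cod (kappa_kernel E))
    (f_equal (@amor_cod _ _ _) (alpha_beta E)).

Lemma dom_cod_split_ext_mor (C : PointedCategory) (F B : arrow_pointed C)
  (E : SplitExt F B) :
  IsSplitExtMor (dom_split_ext E) (cod_split_ext E)
    (arr_map F) (arr_map (mid E)) (arr_map B).
Proof.
split; [| split]; simpl.
- exact (amor_comm (kappa E)).
- exact (amor_comm (beta E)).
- exact (amor_comm (alpha E)).
Qed.

Lemma arrow_split_ext_mor (C : PointedCategory) (F B F' B' : arrow_pointed C)
  (E : SplitExt F B) (E' : SplitExt F' B')
  (u : hom F F') (v : hom (mid E) (mid E')) (w : hom B B') :
  IsSplitExtMor E E' u v w <->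
  IsSplitExtMor (dom_split_ext E) (dom_split_ext E')
    (amor_dom u) (amor_dom v) (amor_dom w) /\
  IsSplitExtMor (cod_split_ext E) (cod_split_ext E')
    (amor_cod u) (amor_cod v) (amor_cod w).
Proof.
split.
- intros [ek [eb ea]]; split; (split; [| split]); simpl;
    first [exact (f_equal (@amor_dom _ _ _) ek) | exact (f_equal (@amor_dom _ _ _) eb)
    | exact (f_equal (@amor_dom _ _ _) ea) | exact (f_equal (@amor_cod _ _ _) ek)
    | exact (f_equal (@amor_cod _ _ _) eb) | exact (f_equal (@amor_cod _ _ _) ea)].
- intros [[ek [eb ea]] [ek' [eb' ea']]]; split; [| split]; now apply ArrowMor_eq.
Qed.

Definition arrow_split_ext (C : PointedCategory) (X B X' B' : C)
  (E : SplitExt X B) (E' : SplitExt X' B') (f : hom X X')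
  (a : hom (mid E) (mid E')) (b : hom B B') (H : IsSplitExtMor E E' f a b) :
  @SplitExt (arrow_pointed C) {| arr_map := f |} {| arr_map := b |}.
Proof.
refine (@Build_SplitExt (arrow_pointed C) {| arr_map := f |} {| arr_map := b |}
  {| arr_map := a |}
  (@Build_ArrowMor C {| arr_map := f |} {| arr_map := a |} (kappa E) (kappa E') (proj1 H))
  (@Build_ArrowMor C {| arr_map := a |} {| arr_map := b |} (alpha E) (alpha E')
    (proj2 (proj2 H)))
  (@Build_ArrowMor C {| arr_map := b |} {| arr_map := a |} (beta E) (beta E')
    (proj1 (proj2 H))) _ _).
- apply arrow_kernel; apply kappa_kernel.
- apply ArrowMor_eq; apply alpha_beta.
Defined.

(** A split extension in the category of morphisms composes with the morphism
    from its codomain part to the generic [G'], so that its domain part [E]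
    acquires a morphism to [G'] with kernel part [f]; the hypothesis on [G]
    says that these are classified by morphisms [E -> G].  The equations
    [a ∘ v = v'] and [b ∘ w = w'] are the commutativity of the resulting
    squares. *)
Lemma arrow_split_ext_generic (C : PointedCategory) (X B Z B' : C)
  (G : SplitExt X B) (G' : SplitExt Z B') (f : hom X Z)
  (a : hom (mid G) (mid G')) (b : hom B B') (H : IsSplitExtMor G G' f a b) :
  IsGeneric G' ->
  (forall (T : C) (E : SplitExt X T) (v' : hom (mid E) (mid G')) (w' : hom T B'),
    IsSplitExtMor E G' f v' w' ->
    exists! vw : hom (mid E) (mid G) * hom T B,
      IsSplitExtMor E G (idm X) (fst vw) (snd vw) /\
      a ∘ fst vw = v' /\ b ∘ snd vw = w') ->
  IsGeneric (arrow_split_ext H).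
Proof.
intros HG' HG T E.
destruct (HG' _ (cod_split_ext E)) as [[v' w'] [Hvw' uniq']]; simpl in *.
assert (Hf := split_ext_mor_comp (dom_cod_split_ext_mor E) Hvw'); simpl in Hf.
rewrite comp_id_l in Hf.
destruct (HG _ (dom_split_ext E) _ _ Hf) as [[v w] [[Hvw [ev ew]] uniq]]; simpl in *.
unshelve eexists (_, _).
- exact (@Build_ArrowMor C (mid E) {| arr_map := a |} v v' ev).
- exact (@Build_ArrowMor C T {| arr_map := b |} w w' ew).
- split.
  + apply arrow_split_ext_mor; split; [exact Hvw | exact Hvw'].
  + intros [v1 w1] H1; apply arrow_split_ext_mor in H1; destruct H1 as [H1 H1'].
    assert (e' := uniq' (amor_cod v1, amor_cod w1) H1').
    injection e' as ev' ew'.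
    assert (e : (v, w) = (amor_dom v1, amor_dom w1)).
    { apply uniq; simpl; split; [exact H1 |].
      rewrite ev', ew'; split; [exact (amor_comm v1) | exact (amor_comm w1)]. }
    injection e as ev1 ew1.
    f_equal; apply ArrowMor_eq; assumption.
Qed.

Theorem proposition3p4
  (C : ProtomodularCategory) (HN : AdmitsNormalizers C)
  (X Z : C) (f : hom X Z)
  (clX clZ : C) (GX : SplitExt X clX) (GZ : SplitExt Z clZ)
  (HGX : IsGeneric GX) (HGZ : IsGeneric GZ)
  (D : NormalizerData ⟨kappa GX, kappa GZ ∘ f⟩) (HD : IsNormalizer D) :
  let XZf : arrow_pointed C := {| arr_map := f |} in
  (exists (cl : arrow_pointed C) (G : SplitExt XZf cl), IsGeneric G) /\
  (forall (cl : arrow_pointed C) (G : SplitExt XZf cl), IsGeneric G ->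
     exists (u : hom (arr_dom cl) (nz_ob D)) (q : hom (arr_dom cl) (clX × clZ)),
       IsPullback (nz_m D) (beta GX ×m beta GZ) u q).
Proof.
intros XZf.
destruct (pullback_exists (finitely_complete C) (nz_m D) (beta GX ×m beta GZ))
  as [P [u [q HP]]].
destruct (normalizer_pullback_represents HGX HD HP) as [G1 [a [Ha HG1]]].
assert (HG := arrow_split_ext_generic Ha HGZ HG1).
split; [eexists _, _; exact HG |].
intros cl G HG'; destruct (generic_base_iso HG' HG) as [i [j [ji ij]]].
exists (u ∘ amor_dom i), (q ∘ amor_dom i).
apply pullback_precomp_iso; [exact HP |].
exists (amor_dom j); split;
  [exact (f_equal (@amor_dom _ _ _) ji) | exact (f_equal (@amor_dom _ _ _) ij)].
Qed.
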